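(* Let $T$ be an $r$-ary GDH theory and let $\mathcal{F}$ be a family of $T$-graphs. Then $\pi_T(\mathcal{F}) = 0$ if and only if some member $F \in \mathcal{F}$ is a subGDH of the $t$-blowup of a single edge for some vector $t = (t_1,\ldots,t_r)$ of positive integers (i.e. $F$ has a copy in $S(t)$, where $S$ is the $T$-graph on $r$ vertices with exactly one edge). Otherwise, $\pi_T(\mathcal{F}) \geq \frac{m_T}{r^r}$.
   Context: Fix an integer $r \geq 2$ and a subgroup $J_T$ of $S_r$ (a GDH theory $T$), with $m_T := |J_T|$. A $T$-graph $G$ is a finite set $V_G$ with a relation $E_G \subseteq V_G^r$ such that every tuple in $E_G$ has pairwise distinct entries and $E_G$ is closed under permuting coordinates by elements of $J_T$. An edge is an orbit of $E_G$ under this $J_T$-action; $e_T(G)$ is the number of edges. A copy of $H$ in $G$ is an injective map $V_H \to V_G$ sending every tuple of $E_H$ to a tuple of $E_G$; $G$ is $\mathcal{F}$-free if it contains no copy of any member of $\mathcal{F}$. $\text{ex}_T(n,\mathcal{F})$ is the maximum number of edges in an $\mathcal{F}$-free $T$-graph on $n$ vertices and $\pi_T(\mathcal{F}) = \lim_{n\to\infty} \text{ex}_T(n,\mathcal{F})/\left(\frac{r!}{m_T}\binom{n}{r}\right)$. For a $T$-graph $G$ with $V_G = \{x_1,\ldots,x_n\}$ and positive integers $t = (t_1,\ldots,t_n)$, the $t$-blowup $G(t)$ has vertex set $\{x_{ij} : 1 \le i \le n, 1 \le j \le t_i\}$ and $(x_{i_1j_1},\ldots,x_{i_rj_r}) \in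 E_{G(t)}$ iff $(x_{i_1},\ldots,x_{i_r}) \in E_G$. *)

(* Defs.v *)
From HB Require Import structures.
From mathcomp Require Import all_boot all_order all_fingroup all_algebra.
From mathcomp Require Import all_classical all_reals all_analysis.
Import numFieldNormedType.Exports.
Import Order.TTheory GRing.Theory Num.Theory.

Set Implicit Arguments.
Unset Strict Implicit.
Unset Printing Implicit Defensive.

Local Open Scope nat_scope.

Section Tuples.
Variable r : nat.

(* (x_1, ..., x_r) |-> (x_(s 1), ..., x_(s r)) *)
Definition permute (V : finType) (x : {ffun 'I_r -> V}) (s : 'S_r)
  : {ffun 'I_r -> V} := [ffun i => x (s i)].

Definition map_tuple (V W : finType) (f : V -> W) (x : {ffun 'I_r -> V})
  : {ffun 'I_r -> W} := [ffun i => f (x i)].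

End Tuples.

Definition is_tgraph (r : nat) (J : {group 'S_r}) (V : finType)
    (E : {set {ffun 'I_r -> V}}) : bool :=
  [forall x in E, injectiveb x] &&
  [forall x in E, forall s in J, permute x s \in E].

Record tgraph (r : nat) (J : {group 'S_r}) (V : finType) : Type := TGraph {
  tuples : {set {ffun 'I_r -> V}};
  tuplesP : is_tgraph J tuples }.

HB.instance Definition _ (r : nat) (J : {group 'S_r}) (V : finType) :=
  [isSub for @tuples r J V].
HB.instance Definition _ (r : nat) (J : {group 'S_r}) (V : finType) :=
  [Finite of tgraph J V by <:].

Definition edges (r : nat) (J : {group 'S_r}) (V : finType) (G : tgraph J V)
  : {set {set {ffun 'I_r -> V}}} :=
  [set [set permute x s | s in J] | x in tuples G].

Definition eT (r : nat) (J : {group 'S_r}) (V : finType) (G : tgraph J V) : nat :=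
  #|edges G|.

Definition has_copy (r : nat) (J : {group 'S_r}) (V W : finType)
    (H : tgraph J V) (G : tgraph J W) : Prop :=
  exists f : V -> W, injective f /\
    forall x, x \in tuples H -> map_tuple f x \in tuples G.

(* A family may be infinite, and may be empty. *)
Definition tfamily (r : nat) (J : {group 'S_r}) : Type :=
  forall V : finType, tgraph J V -> Prop.

Definition is_free (r : nat) (J : {group 'S_r}) (F : tfamily J) (W : finType)
    (G : tgraph J W) : Prop :=
  forall (V : finType) (H : tgraph J V), F V H -> ~ has_copy H G.

(* The value is 0 if no F-free graph on n vertices exists, which requires F to
   contain a graph without edges. *)
Definition exT (r : nat) (J : {group 'S_r}) (F : tfamily J) (n : nat) : nat :=
  \max_(G : tgraph J 'I_n | `[< is_free F G >]) eT G.

Definition piT (R : realType) (r : nat) (J : {group 'S_r}) (F : tfamily J) : R :=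
  (limn (fun n : nat =>
     (exT F n)%:R / (r`!%:R / #|J|%:R * 'C(n, r)%:R) : R))%R.

Section Blowup.
Variables (r : nat) (J : {group 'S_r}) (V : finType) (G : tgraph J V).
Variable t : V -> nat.

(* The vertex x_(i,j) is the dependent pair of i : V and j : 'I_(t i). *)
Definition blowup_tuples : {set {ffun 'I_r -> {i : V & 'I_(t i)}}} :=
  [set x | map_tuple (fun v => tag v) x \in tuples G].

Lemma blowup_is_tgraph : is_tgraph J blowup_tuples.
Proof.
have /andP[/forall_inP Ginj /forall_inP Gcl] := tuplesP G.
apply/andP; split; apply/forall_inP => x; rewrite inE => xG.
  apply/injectiveP => i j xij; apply: (injectiveP (map_tuple _ x) (Ginj _ xG)).
  by rewrite !ffunE xij.
apply/forall_inP => s sJ; rewrite inE.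
have /forall_inP/(_ s sJ) := Gcl _ xG.
suff -> : permute (map_tuple (fun v => tag v) x) s =
          map_tuple (fun v => tag v) (permute x s) by [].
by apply/ffunP => i; rewrite !ffunE.
Qed.

Definition blowup : tgraph J {i : V & 'I_(t i)} := TGraph blowup_is_tgraph.

End Blowup.

Section SingleEdge.
Variables (r : nat) (J : {group 'S_r}).

(* The edge is the orbit of the tuple (0, ..., r - 1). *)
Definition single_edge_tuples : {set {ffun 'I_r -> 'I_r}} :=
  [set permute [ffun i => i] s | s in J].

Lemma single_edge_is_tgraph : is_tgraph J single_edge_tuples.
Proof.
apply/andP; split; apply/forall_inP => _ /imsetP[s sJ ->].
  by apply/injectiveP => i j; rewrite !ffunE; apply: perm_inj.
apply/forall_inP => u uJ; apply/imsetP; exists (u * s)%g; first exact: groupM.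
by apply/ffunP => i; rewrite !ffunE permM.
Qed.

Definition single_edge : tgraph J 'I_r := TGraph single_edge_is_tgraph.

Lemma eT_single_edge : eT single_edge = 1.
Proof.
apply/eqP/cards1P; exists single_edge_tuples; apply/setP => A.
rewrite inE; apply/imsetP/eqP => [[_ /imsetP[s sJ ->] ->]|->]; last first.
  exists [ffun i => i] => //=; apply/imsetP; exists 1%g; first exact: group1.
  by apply/ffunP => i; rewrite !ffunE perm1.
apply/setP => x; apply/imsetP/imsetP => -[u uJ ->].
  exists (u * s)%g; first exact: groupM.
  by apply/ffunP => i; rewrite !ffunE permM.
exists (u * s^-1)%g; first by rewrite groupM ?groupV.
by apply/ffunP => i; rewrite !ffunE permM permKV.
Qed.

End SingleEdge.

(* Main.v *)
Require Import Defs.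
From mathcomp Require Import all_boot all_order all_fingroup all_algebra.
From mathcomp Require Import all_classical all_reals all_analysis.
From mathcomp Require Import zify.
Import numFieldNormedType.Exports.
Import Order.TTheory GRing.Theory Num.Theory.

(** If [n >= r], averaging over the deletion of one vertex shows that
    [ex(n) / n^_r] is nonincreasing, so the limit exists. If no member of [F]
    embeds into a blowup of the single edge, the balanced blowup on [r * k]
    vertices is [F]-free with [k ^ r] edges, which gives the bound [m / r ^ r].
    Otherwise the density vanishes by Erdős's theorem: a set of at least
    [n ^ r / K] ordered [r]-tuples contains a product of [r] sets of size [t]
    once [n] is large. This goes by induction on [r]: a linear number of
    vertices have dense links, and among a fixed number of such vertices [t]
    have links with a dense intersection. Closure under [J] turns the product
    into a copy of the blowup, and injectivity of the tuples makes its factors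
    disjoint. *)

Set Implicit Arguments.
Unset Strict Implicit.
Unset Printing Implicit Defensive.

Local Open Scope nat_scope.

(** * Double counting and pigeonhole for finite families of sets *)

Lemma sum_card_exchange (I Y : finType) (B : {set I}) (e : I -> {set Y}) :
  \sum_(i in B) #|e i| = \sum_y #|[set i in B | y \in e i]|.
Proof.
under eq_bigr do rewrite -sum1_card.
rewrite (exchange_big_dep xpredT) //=.
by apply: eq_bigr => y _; rewrite -sum1_card; apply: eq_bigl => i; rewrite inE.
Qed.

Lemma sum_le_threshold (I : finType) (g : I -> nat) (t M : nat) :
  (forall i, g i <= M) ->
  \sum_i g i <= #|[set i | t <= g i]| * M + #|I| * t.
Proof.
move=> gM; rewrite -sum_nat_const -sum_nat_const [X in _ <= X + _]big_mkcond.
rewrite -big_split /=; apply: leq_sum => i _; rewrite inE.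
by have := gM i; case: (leqP t (g i)); lia.
Qed.

Lemma large_fibre (Y Z : finType) (f : Y -> Z) (Q : {set Z}) (P : {set Y}) :
  0 < #|P| -> (forall y, y \in P -> f y \in Q) ->
  exists2 z, z \in Q & #|P| <= #|Q| * #|[set y in P | f y == z]|.
Proof.
move=> /card_gt0P[y0 y0P] fPQ.
have [z zQ zmax] := @arg_maxnP _ (f y0) (mem Q)
  (fun z => #|[set y in P | f y == z]|) (fPQ _ y0P).
exists z => //; rewrite -sum1_card (partition_big f (mem Q)) //=.
rewrite -sum_nat_const; apply: leq_sum => w wQ; apply: leq_trans (zmax w wQ).
by rewrite -sum1_card leq_eqVlt; apply/orP; left; apply/eqP/eq_bigl => y; rewrite inE.
Qed.

(* Pigeonhole on the trace [{i in B | y \in e i}] of the points [y] whose trace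
   has at least [t] elements. *)
Lemma dense_sets_meet (K t M : nat) (I Y : finType) (B : {set I})
    (e : I -> {set Y}) :
  0 < #|Y| -> M = 4 * K * t -> 0 < M -> #|B| = M ->
  (forall i, i \in B -> #|Y| <= 2 * K * #|e i|) ->
  exists (D : {set I}) (Z : {set Y}),
    [/\ t <= #|D|, #|Y| <= 4 * K * 2 ^ M * #|Z| &
        forall i y, i \in D -> y \in Z -> y \in e i].
Proof.
move=> Y0 defM M0 cB eB.
pose D y := [set i in B | y \in e i].
have DB y : D y \in powerset B by rewrite powersetE; apply/fintype.subsetP => i /setIdP[].
have := @sum_le_threshold _ (fun y => #|D y|) t M.
have DM y : #|D y| <= M by rewrite -cB subset_leq_card // -powersetE.
rewrite -sum_card_exchange => /(_ DM).
have : #|B| * #|Y| <= 2 * K * \sum_(i in B) #|e i|.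
  by rewrite -sum_nat_const big_distrr; apply: leq_sum.
set P := [set y | t <= #|D y|]; set S := \sum_(i in B) _ => h1 h2.
have t0 : 0 < t by lia.
have K0 : 0 < K by lia.
(* Double counting gives [2 * t * #|Y| <= S]. Points outside [P] contribute at most [t * #|Y|] to
   [S], so [P] carries at least that much, with at most [M = 4 * K * t] per point. *)
have h3 : #|Y| <= 4 * K * #|P|.
  rewrite cB defM in h1; rewrite defM in h2.
  have h4 : 2 * t * #|Y| <= S by rewrite -(leq_pmul2l (m := 2 * K)) ?muln_gt0 //; nia.
  by rewrite -(leq_pmul2l t0); nia.
have P0 : 0 < #|P| by lia.
have [A AB cA] := @large_fibre _ _ D (powerset B) P P0 (fun y _ => DB y).
rewrite card_powerset cB in cA.
(* The fibre is inhabited, and any point of it shows [t <= #|A|]. *)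
have [y] : exists y, y \in [set y in P | D y == A].
  by apply/card_gt0P; rewrite lt0n; apply/eqP => z0; rewrite z0 muln0 in cA; lia.
rewrite !inE => /andP[ty /eqP Dy].
exists A, [set y in P | D y == A]; split; first by rewrite -Dy.
  apply: leq_trans h3 _; rewrite -[X in _ <= X]mulnA leq_mul2l cA orbT //.
by move=> i z iA; rewrite inE => /andP[_ /eqP Dz]; move: iA; rewrite -Dz inE => /andP[].
Qed.

(** * Products of large sets inside dense sets of ordered tuples *)

Lemma dense_complete_partite (r K t : nat) :
  exists N, forall (V : finType) (E : {set r.-tuple V}),
    N <= #|V| -> #|V| ^ r <= K * #|E| ->
  exists A : 'I_r -> {set V}, (forall i, t <= #|A i|) /\
    forall x : r.-tuple V, (forall i, tnth x i \in A i) -> x \in E.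
Proof.
wlog t0 : t / 0 < t.
  move=> th; have [N hN] := th t.+1 isT; exists N => V E nV dE.
  have [A [tA AE]] := hN V E nV dE; exists A; split => // i.
  by apply: ltnW; apply: tA.
elim: r K => [|r IH] K.
  exists 0 => V E _; rewrite expn0 => E0.
  have /card_gt0P[x0 x0E] : 0 < #|E| by case: #|E| E0; rewrite ?muln0.
  by exists (fun _ => finset.set0); split => [[]//|x _]; rewrite [x]tuple0 -(tuple0 x0).
pose M := 4 * K * t.
have [N hN] := IH (4 * K * 2 ^ M).
(* The three bounds serve the induction hypothesis, the existence of [M] vertices with dense links,
   and the nonemptiness of [V]. *)
exists (maxn (maxn N (2 * K * M)) 1) => V E.
rewrite !geq_max -andbA => /and3P[NV MV V0] dE.
pose e (v : V) : {set r.-tuple V} := [set y : r.-tuple V | [tuple of v :: y] \in E].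
have sumE : #|E| = \sum_v #|e v|.
  rewrite -sum1_card (partition_big (fun x : r.+1.-tuple V => thead x) xpredT) //=.
  apply: eq_bigr => v _; rewrite sum1_card.
  rewrite -(card_imset (mem (e v)) (f := fun y : r.-tuple V => [tuple of v :: y])); last first.
    by move=> y z /(congr1 val)/= [] /val_inj.
  apply: eq_card => x; apply/andP/imsetP => [[xE /eqP <-]|[y]].
    exists [tuple of behead x]; last exact: tuple_eta.
    by rewrite inE -tuple_eta.
  by rewrite inE => yE ->; rewrite yE theadE.
have K0 : 0 < K.
  by case: (K) dE => //; rewrite mul0n leqn0 expn_eq0; lia.
have Y0 : 0 < #|{:r.-tuple V}| by rewrite card_tuple expn_gt0 V0.
pose H := [set v | #|V| ^ r <= 2 * K * #|e v|].
(* Vertices outside [H] account for at most half of the [#|V| ^ r.+1 / K] tuples guaranteed in [E];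
   each vertex of [H] accounts for at most [#|V| ^ r]. *)
have HV : #|V| <= 2 * K * #|H|.
  have W : 0 < #|V| ^ r by rewrite expn_gt0 V0.
  have h : 2 * K * \sum_v #|e v| <= 2 * K * #|H| * #|V| ^ r + #|V| * #|V| ^ r.
    rewrite big_distrr /= -mulnA (mulnC #|H|) mulnA.
    rewrite [2 * K * _ * _]mulnC -!sum_nat_const [X in _ <= X + _]big_mkcond.
    rewrite -big_split /=; apply: leq_sum => v _; rewrite inE.
    case: (leqP (#|V| ^ r)) => [_|/ltnW]; last by rewrite add0n.
    apply: leq_trans (leq_addr _ _); rewrite leq_mul2l.
    by rewrite -card_tuple max_card orbT.
  rewrite -(leq_pmul2r W); rewrite expnS sumE in dE; nia.
have M0 : 0 < M by rewrite /M !muln_gt0 K0 t0.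
have MH : M <= #|H|.
  rewrite -(leq_pmul2l (m := 2 * K)); first exact: leq_trans MV HV.
  by rewrite muln_gt0 K0.
have [B BH cB] : exists2 B : {set V}, B \subset H & #|B| = M.
  have [B] : exists B, B \in [set A : {set V} | A \subset H & #|A| == M].
    by apply/card_gt0P; rewrite cards_draws bin_gt0.
  by rewrite inE => /andP[? /eqP ?]; exists B.
have [|D [Z [tD dZ DZ]]] := @dense_sets_meet K t M V _ B e Y0 erefl M0 cB.
  by move=> v /(fintype.subsetP BH); rewrite inE card_tuple.
rewrite card_tuple in dZ.
have [A [tA AZ]] := hN V Z NV dZ.
exists (fun i => if unlift ord0 i is Some j then A j else D); split.
  by move=> i; case: unliftP.
move=> x xA; have := xA ord0; rewrite unlift_none => xD.
rewrite (tuple_eta x); suff : [tuple of behead x] \in e (thead x) by rewrite inE.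
apply: DZ => //; apply: AZ => i.
have := xA (lift ord0 i); rewrite liftK tnth_behead.
by have -> : lift ord0 i = inord i.+1 by apply: val_inj; rewrite /= inordK ?ltnS.
Qed.

(** * Tuples, deletions and copies in [T]-graphs *)

Section TGraphs.
Context {r : nat} {J : {group 'S_r}}.

Lemma tuple_injective (V : finType) (G : tgraph J V) x :
  x \in tuples G -> injective x.
Proof. by have /andP[/forall_inP h _] := tuplesP G => /h /injectiveP. Qed.

Lemma permute_tuple (V : finType) (G : tgraph J V) x s :
  s \in J -> x \in tuples G -> permute x s \in tuples G.
Proof. by have /andP[_ /forall_inP h] := tuplesP G => sJ /h /forall_inP/(_ s sJ). Qed.

(** Products in ['S_r] compose from left to right, hence the reversed order. *)
Lemma permuteM (V : finType) (x : {ffun 'I_r -> V}) (s u : 'S_r) :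
  permute (permute x s) u = permute x (u * s)%g.
Proof. by apply/ffunP => i; rewrite !ffunE permM. Qed.

(** Tuples are injective, so [J] acts freely on them and every orbit has [#|J|] elements. *)
Lemma card_tuples (V : finType) (G : tgraph J V) :
  #|tuples G| = eT G * #|J|.
Proof.
rewrite -sum1_card (partition_big_imset (fun x => [set permute x s | s in J])) /=.
rewrite -sum_nat_const; apply: eq_bigr => _ /imsetP[x xG ->].
rewrite sum1_card -(card_imset (mem J) (f := permute x)); last first.
  move=> s u /ffunP su; apply/permP => i; apply: (tuple_injective xG).
  by have := su i; rewrite !ffunE.
apply: eq_card => y; apply/andP/idP => [[yG /eqP <-]|].
  by apply/imsetP; exists 1%g => //; apply/ffunP => i; rewrite ffunE perm1.
case/imsetP => s sJ ->; split; first exact: permute_tuple.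
apply/eqP/setP => z; apply/imsetP/imsetP => -[u uJ ->].
  by exists (u * s)%g; [exact: groupM|exact: permuteM].
by exists (u * s^-1)%g; [rewrite groupM ?groupV|rewrite permuteM mulgKV].
Qed.

Lemma has_copy_trans (U V W : finType) (G1 : tgraph J U) (G2 : tgraph J V)
    (G3 : tgraph J W) :
  has_copy G1 G2 -> has_copy G2 G3 -> has_copy G1 G3.
Proof.
move=> [f [fI fE]] [g [gI gE]]; exists (g \o f); split; first exact: inj_comp.
move=> x /fE/gE; suff -> : Defs.map_tuple g (Defs.map_tuple f x) = Defs.map_tuple (g \o f) x by [].
by apply/ffunP => i; rewrite !ffunE.
Qed.

Section Pullback.
Context {V W : finType} (G : tgraph J V) (f : W -> V).

(** Two maps matter later: [lift v] gives the deletion of [v], and reduction modulo [r] gives the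
    balanced blowup of the single edge. *)
Definition pullback_tuples : {set {ffun 'I_r -> W}} :=
  [set x | Defs.map_tuple f x \in tuples G].

Lemma pullback_is_tgraph : is_tgraph J pullback_tuples.
Proof.
apply/andP; split; apply/forall_inP => x; rewrite inE => xG.
  apply/injectiveP => i j xij; apply: (tuple_injective xG).
  by rewrite !ffunE xij.
apply/forall_inP => s sJ; rewrite inE.
have := permute_tuple sJ xG.
suff -> : permute (Defs.map_tuple f x) s = Defs.map_tuple f (permute x s) by [].
by apply/ffunP => i; rewrite !ffunE.
Qed.

Definition pullback : tgraph J W := TGraph pullback_is_tgraph.

Lemma pullback_copy : injective f -> has_copy pullback G.
Proof. by move=> fI; exists f; split => // x; rewrite inE. Qed.

End Pullback.

(** Double counting of the pairs of a tuple and a vertex it avoids: by injectivity each tuple avoids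
    exactly [n.+1 - r] vertices. *)
Lemma sum_card_deletion (n : nat) (G : tgraph J 'I_n.+1) :
  \sum_(v < n.+1) #|tuples (pullback G (lift v))| = (n.+1 - r) * #|tuples G|.
Proof.
transitivity (\sum_(v < n.+1) \sum_(x in tuples G | v \notin codom x) 1).
  apply: eq_bigr => v _; rewrite sum1_card.
  rewrite -(card_imset _ (f := Defs.map_tuple (lift v))); last first.
    move=> x y /ffunP xy; apply/ffunP => i; have := xy i.
    by rewrite !ffunE => /lift_inj.
  apply: eq_card => x; apply/imsetP/andP => [[y]|[xG vx]].
    rewrite inE => yG ->; split => //; apply/codomP => -[i]; rewrite ffunE.
    by move/eqP; rewrite (negPf (neq_lift _ _)).
  have vxi i : v != x i by apply: contraNneq vx => ->; apply: codom_f.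
  have [y xy] : exists y : {ffun 'I_r -> 'I_n}, forall i, x i = lift v (y i).
    suff h i : exists j, x i == lift v j.
      by exists [ffun i => xchoose (h i)] => i; rewrite ffunE; apply/eqP; exact: (xchooseP (h i)).
    by have [j -> _] := unlift_some (vxi i); exists j.
  have xE : x = Defs.map_tuple (lift v) y by apply/ffunP => i; rewrite ffunE.
  by exists y => //; rewrite inE -xE.
rewrite (exchange_big_dep (mem (tuples G))) /=; last by move=> v x _ /andP[].
rewrite mulnC -sum_nat_const; apply: eq_bigr => x xG.
rewrite -[in RHS](card_ord n.+1) -[in RHS](cardC (mem (codom x))).
rewrite card_codom; last exact: tuple_injective xG.
rewrite card_ord addKn -sum1_card; apply: eq_bigl => v.
by rewrite inE xG.
Qed.

Lemma complete_partite_copy (V : finType) (G : tgraph J V)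
    (A : 'I_r -> {set V}) (t : 'I_r -> nat) :
  (forall i, 0 < t i) -> (forall i, t i <= #|A i|) ->
  (forall x : {ffun 'I_r -> V}, (forall i, x i \in A i) -> x \in tuples G) ->
  has_copy (blowup (single_edge J) t) G.
Proof.
move=> t0 tA AG.
pose mk i a := existT (fun k => 'I_(t k)) i a.
pose f (p : {i : 'I_r & 'I_(t i)}) : V :=
  enum_val (widen_ord (tA (tag p)) (tagged p)).
have fA p : f p \in A (tag p) by apply: enum_valP.
exists f; split.
  case=> [i a] [j b] fab.
  have eij : i = j.
    apply/eqP/negPn/negP => nij.
    (* If parts [i] and [j] met in [f (mk i a) = f (mk j b)], this tuple of [G] would repeat that
       vertex. The other entries are arbitrary members of their parts. *)
    pose x : {ffun 'I_r -> V} := [ffun k => if k == i then f (mk i a) else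
      if k == j then f (mk j b) else f (mk k (Ordinal (t0 k)))].
    have xG : x \in tuples G.
      apply: AG => k; rewrite ffunE.
      case: eqP => [->|_]; first exact: (fA (mk i a)).
      case: eqP => [->|_]; first exact: (fA (mk j b)).
      exact: (fA (mk k (Ordinal (t0 k)))).
    move/negP: nij; apply; apply/eqP; apply: (tuple_injective xG).
    by rewrite !ffunE !eqxx; case: eqP => // _.
  case: j / eij b fab => b /enum_val_inj /(congr1 val) /= ab.
  by congr existT; apply: val_inj.
move=> x; rewrite inE => /imsetP[s sJ /ffunP xs].
have tag_x i : tag (x i) = s i by have := xs i; rewrite !ffunE.
(* Entry [i] of [x] lies over part [s i], so undoing [s] puts every entry over its own index;
   closure under [J] then restores [s]. *)
pose y : {ffun 'I_r -> V} := [ffun k => f (x ((s^-1)%g k))].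
have -> : Defs.map_tuple f x = permute y s.
  by apply/ffunP => i; rewrite !ffunE permK.
apply: permute_tuple => //; apply: AG => k; rewrite ffunE.
by have := fA (x ((s^-1)%g k)); rewrite tag_x permKV.
Qed.

Lemma dense_blowup_copy (t : 'I_r -> nat) (K : nat) :
  (forall i, 0 < t i) ->
  exists N, forall n (G : tgraph J 'I_n), N <= n -> n ^ r <= K * #|tuples G| ->
  has_copy (blowup (single_edge J) t) G.
Proof.
move=> t0; have [N hN] := dense_complete_partite r K (\max_i t i).
exists N => n G Nn dG.
pose toffun (x : r.-tuple 'I_n) : {ffun 'I_r -> 'I_n} := [ffun i => tnth x i].
have toffunK : cancel toffun (fun f => [tuple f i | i < r]).
  by move=> x; apply: eq_from_tnth => i; rewrite tnth_mktuple ffunE.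
have offunK : cancel (fun f : {ffun 'I_r -> 'I_n} => [tuple f i | i < r]) toffun.
  by move=> x; apply/ffunP => i; rewrite ffunE tnth_mktuple.
have [||A [tA AG]] := hN _ [set x | toffun x \in tuples G]; rewrite ?card_ord //.
  rewrite -(card_imset _ (can_inj toffunK)).
  suff -> : toffun @: [set x | toffun x \in tuples G] = tuples G by [].
  apply/setP => x; apply/imsetP/idP => [[y]|xG]; first by rewrite inE => ? ->.
  by exists [tuple x i | i < r]; rewrite ?inE offunK.
apply: complete_partite_copy t0 _ _ => [i|x xA].
  by apply: leq_trans (tA i); apply: leq_bigmax.
have := AG [tuple x i | i < r]; rewrite inE offunK; apply => i.
by rewrite tnth_mktuple.
Qed.

(** * Bounds on extremal numbers *)

Section ExtremalNumber.
Variable F : tfamily J.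

Lemma eT_le_exT (n : nat) (G : tgraph J 'I_n) : is_free F G -> eT G <= exT F n.
Proof.
move=> GF; apply: (@leq_bigmax_cond _ _ (fun G => eT G)).
by apply/asboolP.
Qed.

(** The maximum defining [exT] defaults to 0 when no free graph exists, so positivity is what
    provides a maximiser. *)
Lemma exT_attained (n : nat) :
  0 < exT F n -> exists2 G : tgraph J 'I_n, is_free F G & exT F n = eT G.
Proof.
move=> ex0; have [|G /asboolP GF e] := @eq_bigmax_cond _
  [pred G : tgraph J 'I_n | `[< is_free F G >]] (fun G => eT G).
  rewrite lt0n; apply: contraL ex0 => /eqP/card0_eq e; rewrite -leqNgt.
  by apply/bigmax_leqP => G GF; have := e G; rewrite inE GF.
by exists G.
Qed.

Lemma exT_deletion (n : nat) : (n.+1 - r) * exT F n.+1 <= n.+1 * exT F n.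
Proof.
case: (posnP (exT F n.+1)) => [->|/exT_attained[G GF ->]]; first by rewrite muln0.
(* Multiplying by [#|J|] replaces edges by tuples, which [sum_card_deletion] counts. *)
rewrite -(leq_pmul2r (cardG_gt0 J)) -mulnA -card_tuples -sum_card_deletion.
rewrite -mulnA -[n.+1 in X in _ <= X]card_ord -sum_nat_const.
apply: leq_sum => v _; rewrite card_tuples leq_pmul2r ?cardG_gt0 //.
apply: eT_le_exT => V H HF HG; apply: (GF V H HF).
by apply: has_copy_trans HG _; apply: pullback_copy; apply: lift_inj.
Qed.

(** As [K] is arbitrary, this is [exT F n = o(n ^ r)]: a denser free graph would contain the blowup
    and with it [H]. *)
Lemma exT_sparse (V : finType) (H : tgraph J V) (t : 'I_r -> nat) (K : nat) :
  F H -> (forall i, 0 < t i) -> has_copy H (blowup (single_edge J) t) ->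
  exists N, forall n, N <= n -> K * (#|J| * exT F n) <= n ^ r.
Proof.
move=> HF t0 Ht; have [N hN] := dense_blowup_copy K t0.
exists N => n Nn; case: (posnP (exT F n)) => [->|/exT_attained[G GF ->]].
  by rewrite !muln0.
rewrite mulnC [#|J| * _]mulnC -card_tuples leqNgt; apply/negP => dG.
apply: (GF V H HF); apply: has_copy_trans Ht _; apply: hN => //.
by rewrite mulnC; apply: ltnW.
Qed.

Lemma exT_balanced_blowup (k : nat) :
  0 < r -> 0 < k ->
  (forall (V : finType) (H : tgraph J V) (t : 'I_r -> nat),
     F H -> (forall i, 0 < t i) -> ~ has_copy H (blowup (single_edge J) t)) ->
  k ^ r <= exT F (r * k).
Proof.
move=> r0 k0 HF.
pose f (i : 'I_(r * k)) : 'I_r := Ordinal (ltn_pmod i r0).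
pose G := pullback (single_edge J) f.
have rk0 : 0 < r * k by rewrite muln_gt0 r0.
have GF : is_free F G.
  move=> V H FH HG; apply: (HF V H (fun=> r * k)) => //.
  apply: has_copy_trans HG _.
  (* Each vertex serves as its own index inside its part, so parts of size [r * k] suffice and
     residue classes need no numbering. *)
  pose h i := existT (fun=> 'I_(r * k)) (f i) i.
  exists h; split.
    by move=> i j /(congr1 (fun p : {_ : 'I_r & 'I_(r * k)} => projT2 p)).
  move=> x; rewrite !inE => xG.
  suff -> : Defs.map_tuple (fun v => tag v) (Defs.map_tuple h x) = Defs.map_tuple f x by [].
  by apply/ffunP => i; rewrite !ffunE.
apply: leq_trans (eT_le_exT GF).
rewrite -(leq_pmul2r (cardG_gt0 J)) -card_tuples mulnC.
have lt_rk (a : 'I_r) (b : 'I_k) : b * r + a < r * k.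
  have := ltn_ord a; have := ltn_ord b; nia.
(* With vertices written as quotient and residue modulo [r], a permutation in [J] for the residues
   and a free choice of quotients give [#|J| * k ^ r] tuples. *)
pose g (p : 'S_r * {ffun 'I_r -> 'I_k}) : {ffun 'I_r -> 'I_(r * k)} :=
  [ffun i => Ordinal (lt_rk (p.1 i) (p.2 i))].
have gI : injective g.
  move=> [s y] [u z] /ffunP gE.
  have e i : y i * r + s i = z i * r + u i by have := gE i; rewrite !ffunE => /(congr1 val).
  congr pair; [apply/permP|apply/ffunP] => i; apply: val_inj; have := e i.
    by move/(congr1 (modn^~ r)); rewrite !modnMDl !modn_small.
  by move/(congr1 (divn^~ r)); rewrite !divnMDl // !divn_small ?addn0.
have -> : k ^ r = #|{ffun 'I_r -> 'I_k}| by rewrite card_ffun !card_ord.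
rewrite -cardsT -cardsX -(card_imset _ gI); apply: subset_leq_card.
apply/fintype.subsetP => _ /imsetP[[s y] /setXP[sJ _] ->].
rewrite inE; apply/imsetP; exists s => //; apply/ffunP => i.
by rewrite !ffunE; apply: val_inj; rewrite /= modnMDl modn_small.
Qed.

End ExtremalNumber.
End TGraphs.

(** * Convergence and values of the Turán density *)

Section TuranDensity.
Context {R : realType} {r : nat} {J : {group 'S_r}} (F : tfamily J).
Local Open Scope ring_scope.

(** The ratio in [piT], rewritten with ['C(n, r) * r! = n ^_ r]. *)
Definition turan_ratio (n : nat) : R := (#|J| * exT F n)%N%:R / (n ^_ r)%N%:R.

Lemma piT_turan_ratio : piT R F = limn turan_ratio.
Proof.
rewrite /piT; congr (limn _); apply/funext => n.
rewrite /turan_ratio -bin_ffact !natrM.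
by rewrite [in LHS]invfM invf_div [in RHS]invfM mulrA mulrA -mulrA
  [_^-1 * _^-1]mulrC mulrA [_ * #|J|%:R]mulrC mulrA.
Qed.

Lemma turan_ratio_nonincreasing (n : nat) :
  (r <= n)%N -> turan_ratio n.+1 <= turan_ratio n.
Proof.
move=> rn; have n0 : (0 < n ^_ r)%N by rewrite ffact_gt0.
have n1 : (0 < n.+1 ^_ r)%N by rewrite ffact_gt0 leqW.
rewrite /turan_ratio ler_pdivrMr ?ltr0n // mulrAC ler_pdivlMr ?ltr0n //.
rewrite -!natrM ler_nat -!mulnA leq_pmul2l ?cardG_gt0 //.
have d0 : (0 < n.+1 - r)%N by rewrite subn_gt0.
(* Both sides equal [n.+1 ^_ r.+1], split at its last and at its first factor. *)
have ffE : ((n.+1 - r) * n.+1 ^_ r = n.+1 * n ^_ r)%N.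
  by rewrite mulnC -ffactnSr ffactSS.
by rewrite -(leq_pmul2l d0) mulnA mulnCA ffE mulnA leq_mul2r [X in (_ <= X)%N]mulnC
  exT_deletion orbT.
Qed.

Lemma turan_ratio_antitone (n p : nat) :
  (r <= n)%N -> (n <= p)%N -> turan_ratio p <= turan_ratio n.
Proof.
move=> rn /subnK <-; elim: (p - n)%N => // k IH; apply: le_trans IH.
by apply: turan_ratio_nonincreasing; apply: leq_trans rn (leq_addl _ _).
Qed.

Lemma turan_ratio_ge0 (n : nat) : 0 <= turan_ratio n.
Proof. by rewrite divr_ge0 ?ler0n. Qed.

Lemma turan_ratio_cvg : cvgn turan_ratio.
Proof.
(* Monotonicity starts only at [r]: below it the denominator is 0, so the ratio takes the default
   value 0. *)
suff : cvgn [sequence turan_ratio (n + r)]_n.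
  by move=> /cvg_ex[l]; rewrite cvg_shiftn => /cvgP.
apply: nonincreasing_is_cvgn.
  by move=> n p np; apply: turan_ratio_antitone; rewrite ?leq_addl ?leq_add2r.
by exists 0 => _ [n _ <-]; apply: turan_ratio_ge0.
Qed.

Lemma piT_ge0 : 0 <= piT R F.
Proof.
rewrite piT_turan_ratio; apply: limr_ge; first exact: turan_ratio_cvg.
by near=> n; apply: turan_ratio_ge0.
Unshelve. all: by end_near.
Qed.

Lemma piT_eq0 (V : finType) (H : tgraph J V) (t : 'I_r -> nat) :
  F H -> (forall i, (0 < t i)%N) -> has_copy H (blowup (single_edge J) t) ->
  piT R F = 0.
Proof.
move=> HF t0 Ht; apply/eqP; rewrite eq_le piT_ge0 andbT.
apply/ler_addgt0Pr => e e0; rewrite add0r piT_turan_ratio.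
apply: limr_le; first exact: turan_ratio_cvg.
(* [K] exceeds [2 ^ r / e]. Eventually [K] times the ratio is at most [n ^ r / n ^_ r <= 2 ^ r],
   hence at most [K * e]. *)
pose K := (Num.truncn ((2 ^ r)%N%:R / e)).+1.
have [N hN] := exT_sparse K HF t0 Ht.
near=> n.
have rn : (2 * r <= n)%N by near: n; exact: nbhs_infty_ge.
have Nn : (N <= n)%N by near: n; exact: nbhs_infty_ge.
have n0 : (0 < n ^_ r)%N by rewrite ffact_gt0; lia.
(* Since [2 * r <= n], each of the [r] factors of [n ^_ r] is at least [n / 2]. *)
have ffact_lb : (n ^ r <= 2 ^ r * n ^_ r)%N.
  rewrite ffact_prod -[X in (_ ^ X * _)%N](card_ord r) -[X in (_ ^ X <= _)%N](card_ord r).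
  rewrite -!prod_nat_const -big_split /=; apply: leq_prod => i _.
  by have := ltn_ord i; lia.
rewrite /turan_ratio ler_pdivrMr ?ltr0n //.
have K0 : 0 < K%:R :> R by rewrite ltr0n.
have Ke : (2 ^ r)%N%:R <= K%:R * e.
  by rewrite -ler_pdivrMr // ltW // truncnS_gt.
rewrite -(ler_pM2l K0) -natrM (le_trans _ (_ : (2 ^ r * n ^_ r)%N%:R <= _)) //.
  by rewrite ler_nat (leq_trans (hN _ Nn)).
by rewrite natrM mulrA ler_wpM2r.
Unshelve. all: by end_near.
Qed.

(* For [n >= r] the ratio at [n] dominates the one at [r * n], where the
   balanced blowup with parts of size [n] is [F]-free. *)
Lemma piT_lower_bound :
  (0 < r)%N ->
  (forall (V : finType) (H : tgraph J V) (t : 'I_r -> nat),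
     F H -> (forall i, (0 < t i)%N) -> ~ has_copy H (blowup (single_edge J) t)) ->
  #|J|%:R / (r ^ r)%N%:R <= piT R F.
Proof.
move=> r0 HF; rewrite piT_turan_ratio.
apply: limr_ge; first exact: turan_ratio_cvg.
near=> n.
have rn : (r <= n)%N by near: n; exact: nbhs_infty_ge.
have n0 : (0 < n)%N by apply: leq_trans rn.
apply: le_trans (turan_ratio_antitone rn (leq_pmull n r0)).
have ff0 : (0 < (r * n) ^_ r)%N by rewrite ffact_gt0 leq_pmulr.
rewrite /turan_ratio ler_pdivrMr ?ltr0n ?expn_gt0 ?r0 //.
rewrite mulrAC ler_pdivlMr ?ltr0n // -!natrM ler_nat -mulnA leq_mul2l.
apply/orP; right; apply: (@leq_trans (n ^ r * r ^ r)%N); last first.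
  by rewrite leq_mul2r exT_balanced_blowup ?orbT.
rewrite mulnC -expnMn ffact_prod -[X in (_ <= _ ^ X)%N](card_ord r).
by rewrite -prod_nat_const; apply: leq_prod => i _; apply: leq_subr.
Unshelve. all: by end_near.
Qed.

End TuranDensity.

Theorem mainTheorem6 (R : realType) (r : nat) (hr : (2 <= r)%N)
    (J : {group 'S_r}) (F : tfamily J) :
  (piT R F = 0%R <->
     exists (V : finType) (H : tgraph J V), F V H /\
       exists t : 'I_r -> nat, (forall i : 'I_r, (0 < t i)%N) /\
         has_copy H (blowup (single_edge J) t)) /\
  (piT R F <> 0%R -> (#|J|%:R / (r ^ r)%N%:R <= piT R F :> R)%R).
Proof.
have r0 : 0 < r by apply: ltnW.
have [[V [H [FH [t [t0 Ht]]]]]|noH] := pselect (exists (V : finType)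
    (H : tgraph J V), F V H /\ exists t : 'I_r -> nat,
    (forall i : 'I_r, (0 < t i)%N) /\ has_copy H (blowup (single_edge J) t)).
  have pi0 := piT_eq0 (R := R) FH t0 Ht.
  by split => //; split => // _; exists V, H; split => //; exists t.
(* This bound is positive, so it gives the last claim and also rules out density 0. *)
have lb : (#|J|%:R / (r ^ r)%N%:R <= piT R F :> R)%R.
  apply: piT_lower_bound => // V H t FH t0 Ht; apply: noH.
  by exists V, H; split => //; exists t.
split => //; split => // pi0; move: lb; rewrite pi0 leNgt divr_gt0 //.
  by rewrite ltr0n cardG_gt0.
by rewrite ltr0n expn_gt0 r0.
Qed.
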